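(* Let $G$ be a graph and let $(M,x)\in\mathcal{M}(G)$ satisfy $\vartheta(G)=F(M,x)$. For a positive integer $k$, $\alpha(G^k)=\vartheta(G)^k$ if and only if $G^k$ has an independent set $C$ such that, writing $N=M^{\otimes k}$ and $y=x^{\otimes k}$ (indexed by $V(G)^k$), $N[C]$ is diagonal and, with $c=\max_{u\in V(G^k)}\frac{(N)_{uu}}{y_u^2}$, one has $\frac{(N)_{vv}}{y_v^2}=c$ for all $v\in C$ and $c\,y_v=\sum_{u\in C}(N)_{vu}y_u^{-1}$ for all $v\notin C$. Moreover, if $G^k$ has such an independent set $C$, then $$\alpha(G^k)=\vartheta(G)^k=\Theta(G)^k=|C|.$$
   Context: $\alpha$ is the independence number. $G^k$ is the strong power: vertex set $V(G)^k$, distinct $u_1\cdots u_k$ and $v_1\cdots v_k$ adjacent iff for each $i$, $u_i=v_i$ or $u_iv_i\in E(G)$. $M^{\otimes k}$, $x^{\otimes k}$ are $k$-fold Kronecker products. $\Theta(G)=\lim_k\alpha(G^k)^{1/k}$ is the Shannon capacity. $\mathcal{M}(G)$ is the set of pairs $(M,x)$ with $M$ real positive semidefinite indexed by $V(G)$, $(M)_{ij}=0$ for distinct nonadjacent $i,j$, and $x$ in the column space of $M$ with all entries nonzero. $F(M,x)=x^\top M^\#x\max_u\frac{(M)_{uu}}{x_u^2}$ with $M^\#$ the group inverse (unique $X$ with $MXM=M$, $XMX=X$, $MX=XM$). $N[C]$ is the principal submatrix indexed by $C$. $\vartheta(G)$ is the Lovász theta function: the minimum largest eigenvalue of a real symmetric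 matrix indexed by $V(G)$ with entry $1$ whenever $i=j$ or $i,j$ are nonadjacent. *)

(* Defs.v *)
From mathcomp Require Import all_boot all_order all_algebra.
From mathcomp Require Import all_classical all_reals all_analysis.

Set Implicit Arguments.
Unset Strict Implicit.
Unset Printing Implicit Defensive.

Import Order.TTheory GRing.Theory Num.Theory.
Import numFieldNormedType.Exports.

Local Open Scope classical_set_scope.
Local Open Scope ring_scope.

(* A graph is a symmetric irreflexive relation e on a finite type T.  A matrix
   indexed by T is an element of 'M[R]_#|T|, through the bijection enum_rank. *)

Definition mxent (R : Type) (T : finType) (M : 'M[R]_#|T|) (u v : T) : R :=
  M (enum_rank u) (enum_rank v).

Definition cvent (R : Type) (T : finType) (x : 'cV[R]_#|T|) (u : T) : R :=
  x (enum_rank u) 0.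

Definition prin_submx (R : Type) (T : finType) (M : 'M[R]_#|T|)
    (C : {set T}) : 'M[R]_#|C| :=
  \matrix_(i, j) mxent M (enum_val i) (enum_val j).

Definition independent (T : finType) (e : rel T) (C : {set T}) : bool :=
  [forall u in C, forall v in C, ~~ e u v].

Definition alpha (T : finType) (e : rel T) : nat :=
  \max_(C : {set T} | independent e C) #|C|.

Definition strong_pow (T : finType) (e : rel T) (k : nat) :
    rel {ffun 'I_k -> T} :=
  fun u v => (u != v) && [forall i, (u i == v i) || e (u i) (v i)].
Arguments strong_pow {T} e k.

(* The term k = 0 is 1 and does not affect the limit. *)
Definition shannon (R : realType) (T : finType) (e : rel T) : R :=
  lim ((fun k : nat => (alpha (strong_pow e k))%:R `^ k%:R^-1 : R)
       @ \oo).

(* Supremum and infimum of sets that attain them when T is nonempty. *)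
Definition largest_eigenvalue (R : realType) (n : nat) (A : 'M[R]_n) : R :=
  sup [set a | eigenvalue A a].

Definition lovasz_theta (R : realType) (T : finType) (e : rel T) : R :=
  inf [set largest_eigenvalue A | A in
        [set A : 'M[R]_#|T| | A^T = A /\
           forall u v : T, (u == v) || ~~ e u v -> mxent A u v = 1]].

Definition kron_powmx (R : realType) (T : finType) (M : 'M[R]_#|T|) (k : nat) :
    'M[R]_#|{ffun 'I_k -> T}| :=
  \matrix_(i, j) let u : {ffun 'I_k -> T} := enum_val i in
                 let v : {ffun 'I_k -> T} := enum_val j in
                 \prod_(l < k) mxent M (u l) (v l).

Definition kron_powcv (R : realType) (T : finType) (x : 'cV[R]_#|T|) (k : nat) :
    'cV[R]_#|{ffun 'I_k -> T}| :=
  \col_i let u : {ffun 'I_k -> T} := enum_val i in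
         \prod_(l < k) cvent x (u l).

Definition psd (R : realType) (n : nat) (M : 'M[R]_n) : Prop :=
  M^T = M /\ forall z : 'cV[R]_n, 0 <= (z^T *m M *m z) 0 0.

Definition is_group_inverse (R : realType) (n : nat) (M X : 'M[R]_n) : Prop :=
  [/\ M *m X *m M = M, X *m M *m X = X & M *m X = X *m M].

(* 0 when there is no group inverse, which never happens for psd matrices. *)
Definition group_inverse (R : realType) (n : nat) (M : 'M[R]_n) : 'M[R]_n :=
  xget 0 [set X | is_group_inverse M X].

(* (x^T <= M^T)%MS says that x lies in the column space of M. *)
Definition matrix_class (R : realType) (T : finType) (e : rel T)
    (M : 'M[R]_#|T|) (x : 'cV[R]_#|T|) : Prop :=
  [/\ psd M,
      forall u v : T, u != v -> ~~ e u v -> mxent M u v = 0,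
      (x^T <= M^T)%MS
    & forall u : T, cvent x u != 0].

(* The ratios are nonnegative when M has a nonnegative diagonal, so the default
   value 0 matters only for an empty index type. *)
Definition max_ratio (R : realType) (T : finType) (M : 'M[R]_#|T|)
    (x : 'cV[R]_#|T|) : R :=
  \big[Num.max/0]_(u : T) (mxent M u u / cvent x u ^+ 2).

Definition Fbound (R : realType) (T : finType) (M : 'M[R]_#|T|)
    (x : 'cV[R]_#|T|) : R :=
  (x^T *m group_inverse M *m x) 0 0 * max_ratio M x.

Definition tight_independent (R : realType) (T : finType) (e : rel T)
    (M : 'M[R]_#|T|) (x : 'cV[R]_#|T|) (k : nat)
    (C : {set {ffun 'I_k -> T}}) : Prop :=
  let N := kron_powmx M k in
  let y := kron_powcv x k in
  let c := max_ratio N y in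
  [/\ independent (strong_pow e k) C,
      is_diag_mx (prin_submx N C),
      forall v, v \in C -> mxent N v v / cvent y v ^+ 2 = c
    & forall v, v \notin C ->
        c * cvent y v = \sum_(u in C) mxent N v u * (cvent y u)^-1].

(* Main.v *)
Require Import Defs.
From mathcomp Require Import all_boot all_order all_algebra.
From mathcomp Require Import all_classical all_reals all_analysis.
From mathcomp Require Import ring lra.

Set Implicit Arguments.
Unset Strict Implicit.
Unset Printing Implicit Defensive.

Import Order.TTheory GRing.Theory Num.Theory.
Import numFieldNormedType.Exports.

Local Open Scope ring_scope.

(* Write x = M w, N = M^{(x)k}, y = x^{(x)k} = N W with W = w^{(x)k}.  Then
   x^T M^# x = w^T x, so F(N, y) = (W^T y) c = F(M, x)^k.  For an independent C
   let f be the vector equal to 1/y on C and to 0 elsewhere.  Since N[C] is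
   diagonal,
     (c W - f)^T N (c W - f)
       = c (c W^T y - |C|) + sum_(u in C) (N_uu / y_u^2 - c),
   which is nonnegative because N is a Gram matrix (like M), while the last sum
   is nonpositive; hence |C| <= F(N, y).  In the equality case both vanish, so
   N_uu / y_u^2 = c on C and N f = c N W = c y; conversely N f = c y yields
   c W^T y = W^T N f = y^T f = |C|.  So alpha(G^n) <= theta^n for all n, and
   equality at n = k propagates to the multiples of k by supermultiplicativity
   of alpha, which fixes the Shannon capacity. *)

(** * Squared norms and group inverses of symmetric matrices *)

Lemma mulmx_trE (R : realType) (n m p : nat) (A : 'M[R]_(n, m))
    (B : 'M[R]_(n, p)) i j :
  (A^T *m B) i j = \sum_l A l i * B l j.
Proof. by rewrite mxE; apply: eq_bigr => l _; rewrite mxE. Qed.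

Lemma gram_eq0 (R : realType) (m : nat) (z : 'cV[R]_m) :
  (z^T *m z) 0 0 = 0 -> z = 0.
Proof.
rewrite mulmx_trE => /psumr_eq0P z0; apply/matrixP => i j; rewrite ord1 mxE.
have /eqP := z0 (fun i _ => sqr_ge0 (z i 0)) i isT.
by rewrite mulf_eq0 orbb => /eqP.
Qed.

Lemma gram_ge0 (R : realType) (m : nat) (z : 'cV[R]_m) : 0 <= (z^T *m z) 0 0.
Proof. by rewrite mulmx_trE; apply: sumr_ge0 => i _; exact: sqr_ge0. Qed.

(** Since v^T M^2 v is the squared norm of M v, the kernels of M^2 and M agree, so by ranks M = B
    M^2. Transposing gives M = M^2 A with A = B^T, hence B M = M A, and M A A is the group
    inverse. *)
Lemma symmx_group_inverse (R : realType) (n : nat) (M : 'M[R]_n) :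
  M^T = M -> is_group_inverse M (group_inverse M).
Proof.
move=> Msym; apply: (@xgetPex _ 0).
have kerM : (kermx (M *m M) <= kermx M)%MS.
  apply/sub_kermxP/trmx_inj/matrixP => i j; rewrite trmx0.
  set K := kermx _; have KMM : K *m (M *m M) = 0 by apply/sub_kermxP.
  have: M *m (row j K)^T = 0.
    apply: gram_eq0; rewrite trmx_mul trmxK Msym !mulmxA -row_mul -row_mul.
    by rewrite -mulmxA KMM -row_mul mul0mx !mxE.
  by move=> /matrixP/(_ i 0); rewrite -{1}Msym -trmx_mul -row_mul !mxE.
have /submxP[B MB] : (M <= M *m M)%MS.
  rewrite -(geq_leqif (mxrank_leqif_sup (submxMl M M))).
  have := mxrankS kerM; rewrite !mxrank_ker => rk.
  by rewrite -(leq_sub2lE _ (rank_leq_row M)).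
pose A := B^T; have MA : M = M *m M *m A.
  by apply: trmx_inj; rewrite !trmx_mul trmxK Msym.
have BMA : B *m M = M *m A by rewrite {1}MA !mulmxA -(mulmxA B M M) -MB.
exists (M *m A *m A); split.
- have -> : M *m (M *m A *m A) = M *m A by rewrite !mulmxA -MA.
  by rewrite -BMA -mulmxA -MB.
- have -> : M *m A *m A *m M = M *m A.
    by rewrite -BMA -(mulmxA B) -BMA -!mulmxA -MB BMA.
  by rewrite -{1}BMA !mulmxA -(mulmxA B M M) -MB.
- rewrite !mulmxA -MA.
  by rewrite -BMA -(mulmxA B) -BMA -!mulmxA -MB BMA.
Qed.

(** By M M^# M = M, a preimage of x under M takes the place of the group inverse in [Fbound]. *)
Lemma group_inverse_quad (R : realType) (n : nat) (M : 'M[R]_n) (w : 'cV[R]_n) :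
  M^T = M ->
  (M *m w)^T *m group_inverse M *m (M *m w) = w^T *m (M *m w).
Proof.
move=> Msym; have [MXM _ _] := symmx_group_inverse Msym.
by rewrite trmx_mul Msym -[in RHS]MXM !mulmxA.
Qed.

(** * Gram factorization of positive semidefinite matrices *)

(** Evaluated at e_i + t e_j, the form is 2 t M_ij; t = 1 and t = -1 force M_ij = 0. *)
Lemma psd_diag_eq0 (R : realType) (n : nat) (M : 'M[R]_n) :
  psd M -> (forall i, M i i = 0) -> M = 0.
Proof.
move=> [Msym Mge0] M0; apply/matrixP => i j; rewrite mxE.
have Mij a b : (delta_mx a 0 : 'cV[R]_n)^T *m M *m delta_mx b 0 = (M a b)%:M.
  by rewrite trmx_delta -rowE -colE; apply/matrixP => p q; rewrite !ord1 !mxE.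
have Mji : M j i = M i j by rewrite -{1}Msym mxE.
have form t : 0 <= t * M i j *+ 2.
  have := Mge0 (delta_mx i 0 + t *: delta_mx j 0).
  rewrite [(_ + _)^T]linearD /= [(_ *: _)^T]linearZ /= !mulmxDl !mulmxDr.
  rewrite -!scalemxAl -!scalemxAr !Mij.
  by rewrite !mxE !M0 Mji !mulr1n; lra.
by have := form 1; have := form (-1); lra.
Qed.

(** Completing the square: the Schur complement at z takes the value of M at z - (s / M_ii) e_i,
    where s = (M z)_i. *)
Lemma psd_schur (R : realType) (n : nat) (M : 'M[R]_n) i :
  psd M -> M i i != 0 -> psd (M - (M i i)^-1 *: (col i M *m row i M)).
Proof.
move=> [Msym Mge0] Mii; split=> [|z].
  rewrite [(_ - _)^T]linearB /= [(_ *: _)^T]linearZ /= trmx_mul tr_col tr_row.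
  by rewrite Msym.
pose d : 'cV[R]_n := delta_mx i 0.
have dM : d^T *m M = row i M by rewrite trmx_delta -rowE.
have Md : M *m d = col i M by rewrite -colE.
pose s := (row i M *m z) 0 0.
have sE : row i M *m z = s%:M by apply/matrixP => p q; rewrite !ord1 [RHS]mxE.
have sE' : z^T *m col i M = s%:M.
  by rewrite -[z^T *m _]trmxK trmx_mul trmxK tr_col Msym sE tr_scalar_mx.
have dd : row i M *m d = (M i i)%:M.
  by rewrite -colE; apply/matrixP => p q; rewrite !ord1 !mxE.
have := Mge0 (z - (s / M i i) *: d).
rewrite [(_ - _)^T]linearB /= [(_ *: _)^T]linearZ /= !mulmxBl !mulmxBr.
rewrite -!scalemxAl -!scalemxAr.
rewrite -(mulmxA _ M d) Md dM sE sE' dd mulmxBl -scalemxAl.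
rewrite (mulmxA z^T (col i M)) sE' -(mulmxA s%:M) sE -scalar_mxM.
rewrite !mxE !mulr1n.
by congr (0 <= _); field; rewrite Mii.
Qed.

(** Cholesky factorization, by induction on the number of nonzero diagonal entries: the Schur
    complement clears entry i and keeps the zero ones. *)
Lemma psd_gram (R : realType) (n : nat) (M : 'M[R]_n) :
  psd M -> exists p (B : 'M[R]_(p, n)), M = B^T *m B.
Proof.
have [d] := ubnP #|[set i | M i i != 0]|; elim: d => // d IHd in M *.
rewrite ltnS => leMd Mpsd.
have [i Mii | M0] := pickP (fun i => M i i != 0); last first.
  exists 0%N, 0; rewrite mulmx0; apply: psd_diag_eq0 => // i.
  by have /negbFE/eqP := M0 i.
have [Msym Mge0] := Mpsd.
have psd_diag_ge0 j : 0 <= M j j.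
  by have := Mge0 (delta_mx j 0); rewrite trmx_delta -rowE -colE !mxE.
set M' := M - (M i i)^-1 *: (col i M *m row i M).
have M'E a b : M' a b = M a b - (M i i)^-1 * (M a i * M i b).
  by rewrite !mxE big_ord1 !mxE.
have M'psd : psd M' by exact: psd_schur.
(* If M_jj = 0, then M'_jj = - M_ij^2 / M_ii is at most 0, while psd of [M'] makes it at least 0. *)
have M'z j : M j j = 0 -> M' j j = 0.
  move=> Mjj; apply/eqP; rewrite eq_le; apply/andP; split.
    rewrite M'E Mjj sub0r oppr_le0 mulr_ge0 ?invr_ge0 ?psd_diag_ge0 //.
    have -> : M j i = M i j by rewrite -{1}Msym mxE.
    exact: sqr_ge0.
  have [_ /(_ (delta_mx j 0))] := M'psd.
  by rewrite trmx_delta -rowE -colE !mxE.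
have [|p [B M'B]] := IHd M' _ M'psd.
  apply: leq_trans leMd; apply: proper_card.
  apply/properP; split.
    by apply/fintype.subsetP => j; rewrite !inE; apply: contra_neq => /M'z.
  by exists i; rewrite !inE //= negbK M'E; apply/eqP; field; rewrite Mii.
(* The added row contributes exactly the rank-one matrix that was subtracted in [M']. *)
exists (1 + p)%N, (col_mx ((Num.sqrt (M i i))^-1 *: row i M) B).
rewrite tr_col_mx mul_row_col -M'B [(_ *: _)^T]linearZ /=.
rewrite -scalemxAl -scalemxAr scalerA.
by rewrite -expr2 exprVn sqr_sqrtr // tr_row Msym addrC subrK.
Qed.

(** * Entrywise formulas and Kronecker powers *)

Lemma mxentE (R : realType) (S : finType) (A : 'M[R]_#|S|) (z : 'cV[R]_#|S|) u :
  cvent (A *m z) u = \sum_v mxent A u v * cvent z v.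
Proof.
rewrite /cvent /mxent mxE (reindex enum_rank) //=.
by apply: onW_bij; exact: enum_rank_bij.
Qed.

Lemma dotE (R : realType) (S : finType) (z z' : 'cV[R]_#|S|) :
  (z^T *m z') 0 0 = \sum_u cvent z u * cvent z' u.
Proof.
rewrite mulmx_trE (reindex enum_rank) //=.
by apply: onW_bij; exact: enum_rank_bij.
Qed.

Lemma cvent_inj (R : realType) (S : finType) (z z' : 'cV[R]_#|S|) :
  (forall u, cvent z u = cvent z' u) -> z = z'.
Proof.
move=> zz; apply/matrixP => i j; rewrite ord1.
by have := zz (enum_val i); rewrite /cvent enum_valK.
Qed.

Lemma kron_powmxE (R : realType) (T : finType) (M : 'M[R]_#|T|) k
    (u v : {ffun 'I_k -> T}) :
  mxent (kron_powmx M k) u v = \prod_(l < k) mxent M (u l) (v l).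
Proof. by rewrite {1}/mxent mxE /= !enum_rankK. Qed.

Lemma kron_powcvE (R : realType) (T : finType) (x : 'cV[R]_#|T|) k
    (u : {ffun 'I_k -> T}) :
  cvent (kron_powcv x k) u = \prod_(l < k) cvent x (u l).
Proof. by rewrite {1}/cvent mxE /= !enum_rankK. Qed.

(** Mixed-product rule: [bigA_distr_bigA] expands the product of k coordinate sums into one sum over
    functions. *)
Lemma kron_pow_mulmx (R : realType) (T : finType) (M : 'M[R]_#|T|)
    (w : 'cV[R]_#|T|) k :
  kron_powmx M k *m kron_powcv w k = kron_powcv (M *m w) k.
Proof.
apply: cvent_inj => u; rewrite mxentE kron_powcvE.
under [RHS]eq_bigr do rewrite mxentE.
rewrite bigA_distr_bigA; apply: eq_bigr => v _.
by rewrite kron_powmxE kron_powcvE big_split.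
Qed.

Lemma kron_pow_dot (R : realType) (T : finType) (w x : 'cV[R]_#|T|) k :
  ((kron_powcv w k)^T *m kron_powcv x k) 0 0 = ((w^T *m x) 0 0) ^+ k.
Proof.
rewrite !dotE -[in RHS](card_ord k) -prodr_const bigA_distr_bigA.
by apply: eq_bigr => u _; rewrite !kron_powcvE big_split.
Qed.

(** [B'] is the k-th Kronecker power of B, written out because [kron_powmx] covers square matrices
    only. *)
Lemma kron_pow_gram (R : realType) (T : finType) p (B : 'M[R]_(p, #|T|)) k :
  exists q (B' : 'M[R]_(q, #|{ffun 'I_k -> T}|)),
    kron_powmx (B^T *m B) k = B'^T *m B'.
Proof.
exists #|{ffun 'I_k -> 'I_p}|.
exists (\matrix_(i, j) \prod_(l < k)
  B ((enum_val i : {ffun 'I_k -> 'I_p}) l)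
    (enum_rank ((enum_val j : {ffun 'I_k -> T}) l))).
apply/matrixP => i j; rewrite mulmx_trE mxE /=.
rewrite /mxent; under eq_bigr do rewrite mulmx_trE.
rewrite bigA_distr_bigA [RHS](reindex enum_rank) /=; last first.
  by apply: onW_bij; exact: enum_rank_bij.
by apply: eq_bigr => f _; rewrite !mxE enum_rankK big_split.
Qed.

Lemma max_ratio_ge (R : realType) (S : finType) (N : 'M[R]_#|S|)
    (y : 'cV[R]_#|S|) u : mxent N u u / cvent y u ^+ 2 <= max_ratio N y.
Proof. exact: le_bigmax. Qed.

Lemma max_ratio_ge0 (R : realType) (S : finType) (N : 'M[R]_#|S|)
    (y : 'cV[R]_#|S|) : 0 <= max_ratio N y.
Proof. exact: bigmax_ge_id. Qed.

(** The ratio at u is the product of the ratios at its coordinates, so a constant function at a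
    maximizer attains the maximum. *)
Lemma max_ratio_kron (R : realType) (T : finType) (M : 'M[R]_#|T|)
    (x : 'cV[R]_#|T|) k :
  (forall u, 0 <= mxent M u u) ->
  max_ratio (kron_powmx M k) (kron_powcv x k) = max_ratio M x ^+ k.
Proof.
move=> M_ge0; pose r u := mxent M u u / cvent x u ^+ 2.
have r_ge0 u : 0 <= r u by rewrite divr_ge0 ?sqr_ge0.
have rE (u : {ffun 'I_k -> T}) :
    mxent (kron_powmx M k) u u / cvent (kron_powcv x k) u ^+ 2 =
    \prod_(l < k) r (u l).
  by rewrite kron_powmxE kron_powcvE -prodrXl -prodf_div.
apply/eqP; rewrite eq_le; apply/andP; split.
  apply: bigmax_le => [|u _]; first by rewrite exprn_ge0 ?max_ratio_ge0.
  rewrite rE -[in leRHS](card_ord k) -prodr_const.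
  by apply: ler_prod => l _; rewrite r_ge0 max_ratio_ge.
(* For empty [T] the maximum over [T] is the default 0; at k = 0 the one empty function still has
   ratio 1 = 0^0. *)
have [t _ | T0] := pickP (fun _ : T => true); last first.
  have c0 : max_ratio M x = 0 by rewrite /max_ratio big_pred0.
  case: k rE => [|k] rE; last by rewrite c0 expr0n max_ratio_ge0.
  have f : {ffun 'I_0 -> T} by apply: finfun => -[].
  by apply: le_trans (max_ratio_ge _ _ f); rewrite rE big_ord0.
have [t0 _ ct0] := @eq_bigmax _ _ _ 0 t xpredT r isT (fun _ _ => r_ge0 _).
apply: le_trans (max_ratio_ge _ _ [ffun => t0]).
rewrite rE; under eq_bigr do rewrite ffunE.
by rewrite prodr_const card_ord -ct0.
Qed.

(** * The test vector f and the bound on the size of C *)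

Definition recip_on (R : realType) (S : finType) (C : {set S})
    (y : 'cV[R]_#|S|) : 'cV[R]_#|S| :=
  \col_i if enum_val i \in C then (y i 0)^-1 else 0.

Lemma recip_onE (R : realType) (S : finType) (C : {set S})
    (y : 'cV[R]_#|S|) u :
  cvent (recip_on C y) u = if u \in C then (cvent y u)^-1 else 0.
Proof. by rewrite {1}/cvent mxE enum_rankK. Qed.

Lemma mulmx_recip_on (R : realType) (S : finType) (C : {set S})
    (N : 'M[R]_#|S|) (y : 'cV[R]_#|S|) v :
  cvent (N *m recip_on C y) v = \sum_(u in C) mxent N v u * (cvent y u)^-1.
Proof.
rewrite mxentE [RHS]big_mkcond; apply: eq_bigr => u _.
by rewrite recip_onE; case: ifP; rewrite ?mulr0.
Qed.

Lemma recip_on_dot (R : realType) (S : finType) (C : {set S})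
    (y : 'cV[R]_#|S|) :
  (forall u, cvent y u != 0) -> ((recip_on C y)^T *m y) 0 0 = #|C|%:R.
Proof.
move=> y0; rewrite dotE -sum1_card natr_sum [RHS]big_mkcond.
apply: eq_bigr => u _; rewrite recip_onE.
by case: ifP; rewrite ?mul0r // mulVf.
Qed.

Lemma recip_on_quad (R : realType) (S : finType) (C : {set S})
    (N : 'M[R]_#|S|) (y : 'cV[R]_#|S|) :
  {in C &, forall u v, u != v -> mxent N u v = 0} ->
  ((recip_on C y)^T *m (N *m recip_on C y)) 0 0 =
  \sum_(u in C) mxent N u u / cvent y u ^+ 2.
Proof.
move=> NC; rewrite dotE [RHS]big_mkcond; apply: eq_bigr => u _.
rewrite recip_onE mulmx_recip_on; case: ifP => uC; last by rewrite mul0r.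
rewrite (bigD1 u) //= big1 => [|v /andP[vC vu]]; last first.
  by rewrite NC 1?eq_sym // mul0r.
by rewrite addr0 mulrCA -invfM expr2.
Qed.

(** Both cross terms equal c |C|, as N is symmetric and N W = y, and f^T N f is the sum of the
    ratios over C. One of the two c |C| is moved into that sum. *)
Lemma recip_on_defect (R : realType) (S : finType) p (B : 'M[R]_(p, #|S|))
    (W : 'cV[R]_#|S|) (C : {set S}) (c : R) :
  let N := B^T *m B in let y := N *m W in
  (forall u, cvent y u != 0) ->
  {in C &, forall u v, u != v -> mxent N u v = 0} ->
  let z := B *m (c *: W - recip_on C y) in
  (z^T *m z) 0 0 = c * (c * (W^T *m y) 0 0 - #|C|%:R) +
    \sum_(u in C) (mxent N u u / cvent y u ^+ 2 - c).
Proof.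
move=> N y y0 NC z; set f := recip_on C y.
have Nsym : N^T = N by rewrite trmx_mul trmxK.
have fy : f^T *m y = #|C|%:R%:M.
  by apply/matrixP => i j; rewrite !ord1 recip_on_dot // !mxE.
have Wf : W^T *m (N *m f) = #|C|%:R%:M.
  rewrite mulmxA -{1}Nsym -trmx_mul -/y -[_ *m f]trmxK.
  by rewrite trmx_mul trmxK fy tr_scalar_mx.
rewrite sumrB -recip_on_quad // -/f sumr_const.
have -> : z^T *m z = (c *: W - f)^T *m (N *m (c *: W - f)).
  by rewrite trmx_mul !mulmxA.
rewrite [(_ - _)^T]linearB /= [(_ *: _)^T]linearZ /=.
rewrite !(mulmxBl, mulmxBr, mulmxDl, mulmxDr) -!scalemxAl -!scalemxAr -/y.
rewrite !mulmxN fy Wf.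
by rewrite !mxE !mulr1n -mulr_natr; ring.
Qed.

(** N_uu is the squared norm of column u of B; were that column 0, row u of N would vanish, and so
    would (N W)_u. *)
Lemma gram_ratio_gt0 (R : realType) (S : finType) p (B : 'M[R]_(p, #|S|))
    (W : 'cV[R]_#|S|) u :
  let N := B^T *m B in cvent (N *m W) u != 0 -> 0 < mxent N u u.
Proof.
move=> N; apply: contraNlt => Nuu.
have Bu : col (enum_rank u) B = 0.
  apply: gram_eq0; apply/eqP; rewrite eq_le gram_ge0 andbT.
  apply: le_trans Nuu; rewrite /N /mxent !mulmx_trE.
  by apply: ler_sum => l _; rewrite !mxE.
rewrite /cvent /N -mulmxA mulmx_trE big1 // => l _.
by move/matrixP/(_ l 0): Bu; rewrite !mxE => ->; rewrite mul0r.
Qed.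

Lemma ratio_bound (R : realType) (S : finType) p (B : 'M[R]_(p, #|S|))
    (W : 'cV[R]_#|S|) (C : {set S}) :
  let N := B^T *m B in let y := N *m W in let c := max_ratio N y in
  (forall u, cvent y u != 0) ->
  {in C &, forall u v, u != v -> mxent N u v = 0} ->
  #|C|%:R <= (W^T *m y) 0 0 * c.
Proof.
move=> N y c y0 NC.
have c_ge0 : 0 <= c by exact: max_ratio_ge0.
(* The final division needs c > 0, which an element of C provides; for empty C the bound says that
   the squared norm of B W times c is nonnegative. *)
have [-> | [u uC]] := set_0Vmem C.
  rewrite cards0 mulr_ge0 // /y /N -mulmxA mulmxA -trmx_mul.
  exact: gram_ge0.
have c_gt0 : 0 < c.
  apply: lt_le_trans (max_ratio_ge N y u).
  apply: divr_gt0; first exact: (gram_ratio_gt0 (y0 u)).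
  by rewrite exprn_even_gt0 //=.
have := gram_ge0 (B *m (c *: W - recip_on C y)).
rewrite recip_on_defect // => def_ge0.
have sum_le0 : \sum_(u in C) (mxent N u u / cvent y u ^+ 2 - c) <= 0.
  by apply: sumr_le0 => v _; rewrite subr_le0 max_ratio_ge.
have : 0 <= c * (c * (W^T *m y) 0 0 - #|C|%:R).
  by apply: le_trans def_ge0 _; rewrite gerDl.
by rewrite pmulr_rge0 // subr_ge0 mulrC.
Qed.

(** Equality kills the first term of the defect, so a squared norm equals a sum of nonpositive terms
    and all of them vanish. *)
Lemma ratio_bound_eq (R : realType) (S : finType) p (B : 'M[R]_(p, #|S|))
    (W : 'cV[R]_#|S|) (C : {set S}) :
  let N := B^T *m B in let y := N *m W in let c := max_ratio N y in
  (forall u, cvent y u != 0) ->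
  {in C &, forall u v, u != v -> mxent N u v = 0} ->
  #|C|%:R = (W^T *m y) 0 0 * c ->
  {in C, forall u, mxent N u u / cvent y u ^+ 2 = c} /\
  N *m recip_on C y = c *: y.
Proof.
move=> N y c y0 NC CE.
have := recip_on_defect c y0 NC; rewrite -/N -/y.
rewrite [c * (W^T *m y) 0 0]mulrC -CE subrr mulr0 add0r.
set z := B *m _ => defect.
have term_le0 u : mxent N u u / cvent y u ^+ 2 - c <= 0.
  by rewrite subr_le0 max_ratio_ge.
have sum0 : \sum_(u in C) (mxent N u u / cvent y u ^+ 2 - c) = 0.
  apply/eqP; rewrite eq_le -{2}defect gram_ge0 andbT.
  by apply: sumr_le0.
split=> [u uC|].
  apply/eqP; rewrite -subr_eq0 -oppr_eq0; apply/eqP.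
  move: sum0 => /eqP; rewrite -oppr_eq0 -sumrN => /eqP/psumr_eq0P -> //.
  by move=> v _; rewrite oppr_ge0.
(* B^T z is c y - N f. *)
have : B^T *m z = 0 by rewrite (gram_eq0 (etrans defect sum0)) mulmx0.
by rewrite /z mulmxA mulmxBr -scalemxAr => /eqP; rewrite subr_eq0 => /eqP <-.
Qed.

Lemma ratio_bound_tight (R : realType) (S : finType) p (B : 'M[R]_(p, #|S|))
    (W : 'cV[R]_#|S|) (C : {set S}) (c : R) :
  let N := B^T *m B in let y := N *m W in
  (forall u, cvent y u != 0) ->
  N *m recip_on C y = c *: y -> #|C|%:R = (W^T *m y) 0 0 * c.
Proof.
move=> N y y0 Nf; rewrite -(recip_on_dot C y0).
have Nsym : N^T = N by rewrite trmx_mul trmxK.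
have -> : (W^T *m y) 0 0 * c = (W^T *m (c *: y)) 0 0.
  by rewrite -scalemxAr mulrC [RHS]mxE.
rewrite -Nf mulmxA -{1}Nsym -trmx_mul -/y !dotE.
by apply: eq_bigr => u _; rewrite mulrC.
Qed.

(** * Independent sets and supermultiplicativity of [alpha] on strong powers *)

Lemma independentP (T : finType) (e : rel T) (C : {set T}) :
  reflect {in C &, forall u v, ~~ e u v} (independent e C).
Proof.
apply: (iffP idP) => [/'forall_in_'forall_in_idP indC u v uC vC | indC].
  exact: indC.
by apply/'forall_in_'forall_in_idP => u uC v vC; exact: indC.
Qed.

Lemma alpha_max (T : finType) (e : rel T) (C : {set T}) :
  independent e C -> (#|C| <= alpha e)%N.
Proof. exact: leq_bigmax_cond. Qed.

Lemma alpha_attained (T : finType) (e : rel T) :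
  exists2 C, independent e C & #|C| = alpha e.
Proof.
have ind0 : (0 < #|[pred C | independent e C]|)%N.
  apply/card_gt0P; exists finset.set0; rewrite inE.
  by apply/independentP => u v; rewrite inE.
have [C indC maxC] := bigop.eq_bigmax_cond (fun C : {set T} => #|C|) ind0.
by exists C; rewrite // -maxC.
Qed.

(** Taking a pair lets the image of a product of two vertex sets be formed directly. *)
Definition ffun_cat (T : finType) m n
    (p : {ffun 'I_m -> T} * {ffun 'I_n -> T}) :
    {ffun 'I_(m + n) -> T} :=
  [ffun i : 'I_(m + n) =>
     match fintype.split i with inl j => p.1 j | inr j => p.2 j end].

Lemma ffun_catl (T : finType) m n (p : {ffun 'I_m -> T} * {ffun 'I_n -> T}) j :
  ffun_cat p (lshift n j) = p.1 j.
Proof. by rewrite ffunE (unsplitK (inl j)). Qed.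

Lemma ffun_catr (T : finType) m n (p : {ffun 'I_m -> T} * {ffun 'I_n -> T}) j :
  ffun_cat p (rshift m j) = p.2 j.
Proof. by rewrite ffunE (unsplitK (inr j)). Qed.

Lemma strong_pow_catl (T : finType) (e : rel T) m n
    (p p' : {ffun 'I_m -> T} * {ffun 'I_n -> T}) :
  strong_pow e (m + n) (ffun_cat p) (ffun_cat p') -> p.1 != p'.1 ->
  strong_pow e m p.1 p'.1.
Proof.
move=> /andP[_ /forallP adj] p1; rewrite /strong_pow p1.
by apply/forallP => j; have := adj (lshift n j); rewrite !ffun_catl.
Qed.

Lemma strong_pow_catr (T : finType) (e : rel T) m n
    (p p' : {ffun 'I_m -> T} * {ffun 'I_n -> T}) :
  strong_pow e (m + n) (ffun_cat p) (ffun_cat p') -> p.2 != p'.2 ->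
  strong_pow e n p.2 p'.2.
Proof.
move=> /andP[_ /forallP adj] p2; rewrite /strong_pow p2.
by apply/forallP => j; have := adj (rshift m j); rewrite !ffun_catr.
Qed.

(** Concatenations of maximum independent sets A and B are independent: an edge between two of them
    would restrict to an edge in A or B on any half that differs, and equal words are not
    adjacent. *)
Lemma alpha_strong_powD (T : finType) (e : rel T) m n :
  (alpha (strong_pow e m) * alpha (strong_pow e n) <=
   alpha (strong_pow e (m + n)))%N.
Proof.
have [A indA <-] := alpha_attained (strong_pow e m).
have [B indB <-] := alpha_attained (strong_pow e n).
have cat_inj : injective (@ffun_cat T m n).
  move=> p p' /ffunP eqp; rewrite [p]surjective_pairing [p']surjective_pairing.
  congr pair; apply/ffunP => j.
    by have := eqp (lshift n j); rewrite !ffun_catl.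
  by have := eqp (rshift m j); rewrite !ffun_catr.
rewrite -cardsX -(card_imset _ cat_inj); apply: alpha_max.
apply/independentP => _ _ /imsetP[p pAB ->] /imsetP[p' pAB' ->].
move: pAB pAB'; rewrite !inE => /andP[p1 p2] /andP[p1' p2'].
apply/negP => adj.
have [E1|/(strong_pow_catl adj)] := eqVneq p.1 p'.1; last first.
  by apply/negP; move/independentP: indA; apply.
have [E2|/(strong_pow_catr adj)] := eqVneq p.2 p'.2; last first.
  by apply/negP; move/independentP: indB; apply.
move: adj; rewrite [p]surjective_pairing [p']surjective_pairing E1 E2.
by rewrite /strong_pow eqxx.
Qed.

Lemma alpha_gt0 (T : finType) (e : rel T) (t : T) :
  irreflexive e -> (0 < alpha e)%N.
Proof.
move=> e_irr; rewrite -(cards1 t); apply: alpha_max.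
by apply/independentP => u v /set1P-> /set1P->; rewrite e_irr.
Qed.

Lemma strong_pow_irr (T : finType) (e : rel T) k : irreflexive (strong_pow e k).
Proof. by move=> u; rewrite /strong_pow eqxx. Qed.

(** The remaining r coordinates cost nothing, since the vertex [t] makes [alpha] of every power at
    least 1. *)
Lemma alpha_strong_powM (T : finType) (e : rel T) (t : T) k q r :
  (alpha (strong_pow e k) ^ q <= alpha (strong_pow e (q * k + r)))%N.
Proof.
elim: q => [|q IHq].
  by rewrite expn0 (@alpha_gt0 _ _ [ffun => t]) //; exact: strong_pow_irr.
rewrite expnS mulSn -addnA; apply: leq_trans (alpha_strong_powD _ _ _).
by rewrite leq_mul2l IHq orbT.
Qed.

(** * The limit defining the Shannon capacity *)

(** The n-th root of b_n lies between theta K^(-1/n) and theta, and K^(-1/n) tends to 1. *)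
Lemma cvg_root_sandwich (R : realType) (b : nat -> R) (theta K : R) :
  0 < theta -> 0 < K ->
  (forall n, b n <= theta ^+ n <= K * b n) ->
  ((fun n => b n `^ n%:R^-1) @ \oo --> theta)%classic.
Proof.
move=> theta_gt0 K_gt0 bP.
have b_gt0 n : 0 < b n.
  have /andP[_ le] := bP n; rewrite -(pmulr_rgt0 _ K_gt0).
  by apply: lt_le_trans le; exact: exprn_gt0.
have thetaE n : (theta ^+ n.+1) `^ n.+1%:R^-1 = theta.
  by rewrite -powR_mulrn ?ltW // -powRrM mulfV ?pnatr_eq0 // powRr1 ?ltW.
(* At n = 0 the exponent [0^-1] is 0 and the root of theta^n is 1, not theta; the shift drops this
   term. *)
rewrite -(cvg_shiftS (fun n => b n `^ n%:R^-1)) /=.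
have powE n : K^-1 `^ n.+1%:R^-1 = expR (n.+1%:R^-1 * ln K^-1).
  by rewrite /powR gt_eqF ?invr_gt0.
have Kcvg : ((fun n => theta * K^-1 `^ n.+1%:R^-1) @ \oo --> theta)%classic.
  under eq_fun => n do rewrite powE.
  suff : ((fun n => theta * expR (n.+1%:R^-1 * ln K^-1)) @ \oo -->
      theta * expR (0 * ln K^-1))%classic by rewrite mul0r expR0 mulr1.
  apply: cvgMl_tmp; apply: continuous_cvg; first exact: continuous_expR.
  by apply: cvgMr_tmp; exact: cvg_harmonic.
apply: (squeeze_cvgr _ Kcvg (cvg_cst theta)).
apply: nearW => n; have /andP[le1 le2] := bP n.+1.
have root_le (a b' : R) :
    0 <= a -> a <= b' -> a `^ n.+1%:R^-1 <= b' `^ n.+1%:R^-1.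
  move=> a0 ab; rewrite ge0_ler_powR ?invr_ge0 // nnegrE //.
  exact: le_trans ab.
have theta_ge0 := exprn_ge0 n.+1 (ltW theta_gt0).
have -> : theta * K^-1 `^ n.+1%:R^-1 = (theta ^+ n.+1 / K) `^ n.+1%:R^-1.
  by rewrite powRM ?thetaE // invr_ge0 ltW.
apply/andP; split; last first.
  by rewrite -[leRHS](thetaE n) root_le // ltW.
by rewrite root_le ?divr_ge0 ?(ltW K_gt0) // ler_pdivrMr // mulrC.
Qed.

(** Writing n = q k + r with r < k, theta^(q k) = alpha(G^k)^q is at most alpha(G^n), so alpha(G^n)
    is within a constant factor of theta^n. *)
Lemma shannon_eq (R : realType) (T : finType) (e : rel T) (theta : R) k :
  (0 < k)%N -> 0 <= theta ->
  (forall n, (alpha (strong_pow e n))%:R <= theta ^+ n) ->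
  (alpha (strong_pow e k))%:R = theta ^+ k -> shannon R e = theta.
Proof.
move=> k_gt0 theta_ge0 ub alphak.
apply: cvg_lim => //.
(* Without vertices, [alpha] of every positive power is 0; then theta = 0 and the sequence is 0 from
   index 1 on. *)
have [t _ | T0] := pickP (fun _ : T => true); last first.
  have alpha0 n : (0 < n)%N -> alpha (strong_pow e n) = 0%N.
    move=> n_gt0; apply/eqP; rewrite -leqn0; apply/bigmax_leqP => C _.
    apply: leq_trans (max_card _) _; rewrite card_ffun card_ord.
    by rewrite (eq_card0 T0) exp0n.
  have -> : theta = 0.
    by move/esym/eqP: alphak; rewrite alpha0 // expf_eq0 k_gt0 => /eqP.
  rewrite -cvg_shiftS /=.
  apply: cvg_near_cst; apply: nearW => n.
  by rewrite alpha0 // powR0 // invr_eq0 pnatr_eq0.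
have alpha_ge1 n : 1 <= (alpha (strong_pow e n))%:R :> R.
  by rewrite ler1n (@alpha_gt0 _ _ [ffun => t]) //; exact: strong_pow_irr.
have theta_ge1 : 1 <= theta by rewrite -[theta]expr1 (le_trans (alpha_ge1 1%N)).
have theta_gt0 : 0 < theta by exact: lt_le_trans theta_ge1.
(* The constant theta^k dominates theta^(n mod k) because theta is at least 1. *)
apply: (@cvg_root_sandwich _ _ _ (theta ^+ k)) => //; first exact: exprn_gt0.
move=> n; rewrite ub /=.
have lb : theta ^+ (n %/ k * k) <= (alpha (strong_pow e n))%:R.
  rewrite mulnC exprM -alphak -natrX ler_nat.
  by have := alpha_strong_powM e t k (n %/ k) (n %% k); rewrite -divn_eq.
apply: le_trans (ler_wpM2l (exprn_ge0 k theta_ge0) lb).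
rewrite -exprD ler_weXn2l // {1}(divn_eq n k) addnC leq_add2r.
by rewrite ltnW // ltn_mod.
Qed.

(** * The bound and its equality case for strong powers *)

(** Supplies the Gram factor and the preimage W that the ratio bounds take as input; both factors of
    F are multiplicative under Kronecker powers. *)
Lemma matrix_class_kron (R : realType) (T : finType) (e : rel T)
    (M : 'M[R]_#|T|) (x : 'cV[R]_#|T|) k :
  matrix_class e M x ->
  exists p (B : 'M[R]_(p, #|{ffun 'I_k -> T}|)) W,
    [/\ kron_powmx M k = B^T *m B, kron_powcv x k = B^T *m B *m W
      & (W^T *m kron_powcv x k) 0 0 *
        max_ratio (kron_powmx M k) (kron_powcv x k) = Fbound M x ^+ k].
Proof.
move=> [Mpsd _ /submxP[D xD] _]; have [Msym _] := Mpsd.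
have {D xD} [w xE] : exists w, x = M *m w.
  by exists D^T; rewrite -[x]trmxK xD trmx_mul trmxK.
have [p [B MB]] := psd_gram Mpsd.
have [q [B' NB']] := kron_pow_gram B k; rewrite -MB in NB'.
exists q, B', (kron_powcv w k); split=> //.
  by rewrite -NB' kron_pow_mulmx xE.
rewrite max_ratio_kron => [|u]; last first.
  by rewrite MB /mxent mulmx_trE; apply: sumr_ge0 => l _; exact: sqr_ge0.
by rewrite kron_pow_dot /Fbound exprMn xE group_inverse_quad.
Qed.

(** Distinct nonadjacent words have a coordinate with distinct nonadjacent letters, and the factor
    of N_uv there is 0. *)
Lemma independent_kron0 (R : realType) (T : finType) (e : rel T)
    (M : 'M[R]_#|T|) (x : 'cV[R]_#|T|) k (C : {set {ffun 'I_k -> T}}) :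
  matrix_class e M x -> independent (strong_pow e k) C ->
  {in C &, forall u v, u != v -> mxent (kron_powmx M k) u v = 0}.
Proof.
move=> [_ M0 _ _] /independentP indC u v uC vC uv.
have := indC _ _ uC vC; rewrite /strong_pow uv /= negb_forall.
case/existsP => l; rewrite negb_or => /andP[ul nadj].
by rewrite kron_powmxE (bigD1 l) //= M0 // mul0r.
Qed.

Lemma kron_powcv_neq0 (R : realType) (T : finType) (e : rel T)
    (M : 'M[R]_#|T|) (x : 'cV[R]_#|T|) k (u : {ffun 'I_k -> T}) :
  matrix_class e M x -> cvent (kron_powcv x k) u != 0.
Proof.
by move=> [_ _ _ x0]; rewrite kron_powcvE; apply/prodf_neq0 => l _.
Qed.

Lemma card_independent_le (R : realType) (T : finType) (e : rel T)
    (M : 'M[R]_#|T|) (x : 'cV[R]_#|T|) k (C : {set {ffun 'I_k -> T}}) :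
  matrix_class e M x -> independent (strong_pow e k) C ->
  #|C|%:R <= Fbound M x ^+ k.
Proof.
move=> Mx indC; have [p [B [W [NB yW <-]]]] := matrix_class_kron k Mx.
have NC := independent_kron0 Mx indC.
have y0 (u : {ffun 'I_k -> T}) := kron_powcv_neq0 u Mx.
by rewrite NB yW; apply: ratio_bound => [u|]; rewrite -?yW -?NB.
Qed.

(** Both sides amount to N f = c y. At v in C, (N f)_v = N_vv / y_v, which gives the ratio
    condition; outside C the equation is the sum condition. *)
Lemma card_independent_eq (R : realType) (T : finType) (e : rel T)
    (M : 'M[R]_#|T|) (x : 'cV[R]_#|T|) k (C : {set {ffun 'I_k -> T}}) :
  matrix_class e M x -> independent (strong_pow e k) C ->
  (#|C|%:R = Fbound M x ^+ k <-> tight_independent e M x C).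
Proof.
move=> Mx indC; have [p [B [W [NB yW <-]]]] := matrix_class_kron k Mx.
have NC := independent_kron0 Mx indC.
have y0 (u : {ffun 'I_k -> T}) := kron_powcv_neq0 u Mx.
rewrite /tight_independent; set c := max_ratio _ _.
have NfE v : v \in C ->
    cvent (kron_powmx M k *m recip_on C (kron_powcv x k)) v =
    mxent (kron_powmx M k) v v / cvent (kron_powcv x k) v.
  move=> vC; rewrite mulmx_recip_on (bigD1 v) //= big1 ?addr0 //.
  by move=> u /andP[uC uv]; rewrite NC 1?eq_sym // mul0r.
split.
  rewrite {}/c in NfE *; rewrite NB yW => CE.
  have [||ratioC Nf] := @ratio_bound_eq _ _ _ B W C _ _ CE.
  - by move=> u; rewrite -yW.
  - by rewrite -NB.
  rewrite -?yW -?NB in ratioC Nf *; split=> //.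
    apply/is_diag_mxP => i j ij; rewrite mxE NC ?enum_valP //.
    by apply: contra_neq ij => /enum_val_inj ->.
  by move=> v _; rewrite -mulmx_recip_on Nf [RHS]mxE.
case=> _ _ ratioC Nf.
have {}Nf : kron_powmx M k *m recip_on C (kron_powcv x k) = c *: kron_powcv x k.
  apply: cvent_inj => v; rewrite [RHS]mxE -/(cvent _ v).
  have [vC|vC] := boolP (v \in C); last by rewrite Nf // mulmx_recip_on.
  by rewrite NfE // -(ratioC v vC); field; exact: y0.
by rewrite yW; apply: ratio_bound_tight; rewrite -yW -?NB.
Qed.

Theorem theorem8p1 (R : realType) (T : finType) (e : rel T)
    (e_sym : symmetric e) (e_irr : irreflexive e)
    (M : 'M[R]_#|T|) (x : 'cV[R]_#|T|) (Mx : matrix_class e M x)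
    (thetaF : lovasz_theta R e = Fbound M x) (k : nat) (k_gt0 : (0 < k)%N) :
  ((alpha (strong_pow e k))%:R = lovasz_theta R e ^+ k
     <-> exists C : {set {ffun 'I_k -> T}}, tight_independent e M x C) /\
  (forall C : {set {ffun 'I_k -> T}}, tight_independent e M x C ->
     [/\ (alpha (strong_pow e k))%:R = lovasz_theta R e ^+ k,
         lovasz_theta R e ^+ k = shannon R e ^+ k
       & shannon R e ^+ k = #|C|%:R]).
Proof.
rewrite thetaF.
have ub n : (alpha (strong_pow e n))%:R <= Fbound M x ^+ n.
  have [C indC <-] := alpha_attained (strong_pow e n).
  exact: (card_independent_le Mx indC).
(* A tight C has |C| = F^k, and |C| is at most alpha(G^k), which is at most F^k. *)
have tight (C : {set {ffun 'I_k -> T}}) : tight_independent e M x C ->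
    (alpha (strong_pow e k))%:R = Fbound M x ^+ k /\ Fbound M x ^+ k = #|C|%:R.
  move=> tC; have [indC _ _ _] := tC.
  have CE := (card_independent_eq Mx indC).2 tC; split=> //.
  by apply/eqP; rewrite eq_le ub -CE ler_nat alpha_max.
split; first split.
(* A maximum independent set is the witness. *)
- have [C indC <-] := alpha_attained (strong_pow e k) => CE.
  by exists C; apply/(card_independent_eq Mx indC).
- by case=> C /tight[].
move=> C /tight[alphaE CE].
have F_ge0 : 0 <= Fbound M x.
  by have := ub 1%N; rewrite expr1; apply: le_trans.
by rewrite (shannon_eq k_gt0 F_ge0 ub alphaE).
Qed.
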